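(* Assume that the reduced chain $Y$ is irreducible. Then for any probability distribution $\pi$ concentrated on the slow state space $B$, $$\lim_{\lambda\to\infty}\ \sup_{t\ge0} d_{TV}\bigl(P^\lambda_\pi(X_t\in\cdot),\,P_\pi(Y_t\in\cdot)\bigr)=0 .$$
   Context: Setting. $S=\{1,\dots,|S|\}$ is a finite set. For each $\lambda>0$, $Q(\lambda)=(q_{ij}(\lambda))$ is an irreducible transition rate matrix on $S$ (nonnegative off-diagonal entries, rows summing to $0$), and $X=\{X_t:t\ge0\}$ is the continuous-time Markov chain on $S$ with transition rate matrix $Q(\lambda)$; $P^\lambda_\pi$ denotes its law with initial distribution $\pi$, and $P^\lambda_i$ its law started from state $i$. For all $i\ne j$, $\lim_{\lambda\to\infty}q_{ij}(\lambda)$ exists in $[0,\infty]$. Put $q_i(\lambda)=-q_{ii}(\lambda)=\sum_{j\ne i}q_{ij}(\lambda)$ and $q_i=\lim_{\lambda\to\infty}q_i(\lambda)\in[0,\infty]$. The fast state space is $A=\{i:q_i=\infty\}$ and the slow state space is $B=\{i:q_i<\infty\}$; it is assumed that $B\neq\emptyset$ and $q_i>0$ for all $i\in B$. States are labelled so that those of $A$ come first, and matrices on $S$ are written in blocks with indices $A,B$ (row vectors likewise). $Q=\lim_{\lambda\to\infty}Q(\lambda)$ entrywise; the blocks $Q_{BA},Q_{BB}$ have finite entries. Jump chain. $\Omega(\lambda)=(\omega_{ij}(\lambda))$ with $\omega_{ij}(\lambda)=q_{ij}(\lambda)/q_i(\lambda)$ for $i\neq j$ and $\omega_{ii}(\lambda)=0$.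 It is assumed that $\lim_{\lambda\to\infty}\omega_{ij}(\lambda)$ exists for all $i\ne j$; $\Omega=\lim_{\lambda\to\infty}\Omega(\lambda)$ is a stochastic matrix. Let $\eta=\{\eta_n\}_{n\ge0}$ be the discrete-time Markov chain with transition matrix $\Omega$ and $T_B=\inf\{n\ge0:\eta_n\in B\}$; it is assumed that $P_i(T_B<\infty)=1$ for all $i\in A$. Then $I-\Omega_{AA}$ is invertible. Reduced chain. $Y=\{Y_t:t\ge0\}$ is the continuous-time Markov chain on $B$ with transition rate matrix $\Gamma=Q_{BB}+Q_{BA}(I-\Omega_{AA})^{-1}\Omega_{AB}$; $P_\pi$ (resp. $P_i$) denotes its law with initial distribution $\pi$ on $B$ (resp. started from $i\in B$). Distributions on $B$ are regarded as distributions on $S$ giving mass $0$ to $A$. Total variation distance: $d_{TV}(\mu,\nu)=\frac12\sum_{i\in S}|\mu_i-\nu_i|$ for probability measures $\mu,\nu$ on $S$. *)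

(* Defs.v *)
From HB Require Import structures.
From mathcomp Require Import all_boot all_order all_algebra.
From mathcomp Require Import all_classical all_reals all_analysis.

Set Implicit Arguments.
Unset Strict Implicit.
Unset Printing Implicit Defensive.

Import Order.TTheory GRing.Theory Num.Theory.
Import numFieldNormedType.Exports.

Local Open Scope classical_set_scope.
Local Open Scope ring_scope.

Section Matrices.
Context {R : realType} {n : nat}.
Implicit Types (G P : 'M[R]_n) (mu nu : 'rV[R]_n) (Pt : R -> 'M[R]_n).

Definition is_distr mu := (forall i, 0 <= mu 0 i) /\ \sum_i mu 0 i = 1.

Definition stochastic_mx P :=
  (forall i j, 0 <= P i j) /\ (forall i, \sum_j P i j = 1).

Definition rate_mx G :=
  (forall i j, i != j -> 0 <= G i j) /\ (forall i, \sum_j G i j = 0).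

Definition irreducible_rate_mx G :=
  forall i j : 'I_n, connect (fun x y => (x != y) && (0 < G x y)) i j.

Definition exit_rate G (i : 'I_n) : R := - G i i.

Definition jump_mx G : 'M[R]_n :=
  \matrix_(i, j) (if i == j then 0 else G i j / exit_rate G i).

(* For a rate matrix [G] this characterizes [Pt t = exp (t G)] on [t >= 0];
   [Pt] is unconstrained at negative times. *)
Definition transition_semigroup Pt G :=
  [/\ forall t, 0 <= t -> stochastic_mx (Pt t),
      Pt 0 = 1%:M,
      forall s t, 0 <= s -> 0 <= t -> Pt (s + t) = Pt s *m Pt t &
      forall i j, (Pt h - 1%:M) i j / h @[h --> 0^'+] --> G i j].

Definition dTV mu nu : R := 2^-1 * \sum_i `|mu 0 i - nu 0 i|.

End Matrices.

Section Processes.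
Context {R : realType} {n : nat} {d : measure_display} {T : measurableType d}.
Implicit Types (P : probability T R) (init : 'rV[R]_n).

Definition law P (Z : T -> 'I_n) : 'rV[R]_n :=
  \row_i fine (P (Z @^-1` [set i])).

(* [init] is the initial distribution; the chain is specified by its
   finite-dimensional distributions. *)
Definition is_dtmc P (eta : nat -> T -> 'I_n) init (W : 'M[R]_n) :=
  (forall k i, measurable (eta k @^-1` [set i])) /\
  forall (N : nat) (s : nat -> 'I_n),
    P [set w | forall k, (k <= N)%N -> eta k w = s k] =
    (init 0 (s 0%N) * \prod_(k < N) W (s k) (s k.+1))%:E.

(* No path regularity is required; values [X t] at [t < 0] are irrelevant. *)
Definition is_ctmc P (X : R -> T -> 'I_n) init (G : 'M[R]_n) :=
  (forall t i, 0 <= t -> measurable (X t @^-1` [set i])) /\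
  exists2 Pt : R -> 'M[R]_n, transition_semigroup Pt G &
  forall (N : nat) (t : nat -> R) (s : nat -> 'I_n),
    t 0%N = 0 -> nondecreasing_seq t ->
    P [set w | forall k, (k <= N)%N -> X (t k) w = s k] =
    (init 0 (s 0%N) * \prod_(k < N) Pt (t k.+1 - t k) (s k) (s k.+1))%:E.

(* [+oo] when [B] is never hit, as the infimum of the empty set. *)
Definition hitting_time (eta : nat -> T -> 'I_n) (B : set 'I_n) (w : T) :
    \bar R :=
  ereal_inf [set (k%:R)%:E | k in [set k | B (eta k w)]].

End Processes.

Section Limits.
Context {R : realType}.

Section Whole.
Context {n : nat}.
Implicit Type Q : R -> 'M[R]_n.

Definition lim_rate Q (i j : 'I_n) : \bar R :=
  lim ((Q lambda i j)%:E @[lambda --> +oo%R]).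

Definition lim_exit_rate Q (i : 'I_n) : \bar R :=
  lim ((exit_rate (Q lambda) i)%:E @[lambda --> +oo%R]).

Definition fast_states Q : set 'I_n := [set i | lim_exit_rate Q i = +oo%E].

Definition slow_states Q : set 'I_n := [set i | (lim_exit_rate Q i < +oo)%E].

(* [fine] sends infinite limits to [0]; these occur only in rows indexed by
   fast states. *)
Definition lim_rate_mx Q : 'M[R]_n := \matrix_(i, j) fine (lim_rate Q i j).

Definition lim_jump_mx Q : 'M[R]_n :=
  \matrix_(i, j) lim (jump_mx (Q lambda) i j @[lambda --> +oo%R]).

End Whole.

(* To be used when the first [a] states are the fast ones and the last [b]
   states the slow ones. *)
Definition reduced_rate_mx {a b : nat} (Q : R -> 'M[R]_(a + b)) : 'M[R]_b :=
  let QL := lim_rate_mx Q in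
  let W := lim_jump_mx Q in
  drsubmx QL + dlsubmx QL *m invmx (1%:M - ulsubmx W) *m ursubmx W.

(* A row vector indexed by the slow states, extended by mass [0] on the fast
   ones. *)
Definition extend0 {a b : nat} (mu : 'rV[R]_b) : 'rV[R]_(a + b) :=
  row_mx 0 mu.

End Limits.

(* Main.v *)
Require Import Defs.
From HB Require Import structures.
From mathcomp Require Import all_boot all_order all_algebra.
From mathcomp Require Import all_classical all_reals all_analysis.
From mathcomp Require Import ring lra.

Set Implicit Arguments.
Unset Strict Implicit.
Unset Printing Implicit Defensive.

Import Order.TTheory GRing.Theory Num.Theory.
Import numFieldNormedType.Exports.

Local Open Scope classical_set_scope.
Local Open Scope ring_scope.

(* Let H i j be the probability that the limiting jump chain started at the
   fast state i enters the slow states at j, and let K = (H; I) be the matrix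
   projecting S onto B. Two facts hold uniformly in t >= 0.
   - The mass p_A(t) on the fast states is O(1 / q_i(lambda)): x_i / q_i(lambda)
     on A and 1 on B is a supersolution of the forward equation as soon as
     x (I - W_AA) exceeds the rates from B into A, W being the limiting jump
     matrix.
   - Since W K = K on the fast rows, Q(lambda) K - K Gamma is small when
     weighted by that supersolution, so p(t) K follows the semigroup of Gamma up
     to an error that is small per unit of time. Irreducibility of Gamma gives a
     Doeblin contraction on zero-sum rows, which keeps these errors from
     accumulating as t grows.
   All differential estimates are made on subdivisions of [0, t] with steps
   tending to 0, so that only right derivatives at 0 of the semigroups are
   needed. *)

(** * Limits of finite sums *)

Lemma cvg_sumr {R : realType} {T I : Type} {F : set_system T} {FF : Filter F}
    (r : seq I) (p : pred I) (f : I -> T -> R) (l : I -> R) :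
  (forall i, p i -> f i x @[x --> F] --> l i) ->
  \sum_(i <- r | p i) f i x @[x --> F] --> \sum_(i <- r | p i) l i.
Proof. by move=> fl; apply: cvg_big => //; exact: add_continuous. Qed.

Lemma cvg_sumr0 {R : realType} {T I : Type} {F : set_system T} {FF : Filter F}
    (r : seq I) (p : pred I) (f : I -> T -> R) :
  (forall i, p i -> f i x @[x --> F] --> 0) ->
  \sum_(i <- r | p i) f i x @[x --> F] --> 0.
Proof. by move=> /cvg_sumr => /(_ r); rewrite big1_eq. Qed.

(** * The entrywise norm and the action of stochastic matrices *)

Section L1Norm.
Context {R : realType}.

Definition l1 {m n : nat} (M : 'M[R]_(m, n)) : R := \sum_i \sum_j `|M i j|.

Lemma l1_0 {m n} : l1 (0 : 'M[R]_(m, n)) = 0.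
Proof.
by rewrite /l1 big1// => i _; rewrite big1// => j _; rewrite mxE normr0.
Qed.

Lemma l1D {m n} (M N : 'M[R]_(m, n)) : l1 (M + N) <= l1 M + l1 N.
Proof.
rewrite /l1 -big_split; apply: ler_sum => i _ /=.
by rewrite -big_split; apply: ler_sum => j _ /=; rewrite mxE ler_normD.
Qed.

Lemma l1N {m n} (M : 'M[R]_(m, n)) : l1 (- M) = l1 M.
Proof.
by apply: eq_bigr => i _; apply: eq_bigr => j _; rewrite mxE normrN.
Qed.

Lemma l1Z {m n} (c : R) (M : 'M[R]_(m, n)) : l1 (c *: M) = `|c| * l1 M.
Proof.
rewrite /l1 mulr_sumr; apply: eq_bigr => i _; rewrite mulr_sumr.
by apply: eq_bigr => j _; rewrite mxE normrM.
Qed.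

Lemma l1_row {n} (v : 'rV[R]_n) : l1 v = \sum_j `|v 0 j|.
Proof. by rewrite /l1 big_ord1. Qed.

(** Weighting by [z] lets a row of [M] with large entries be offset by a small mass there; this is
    how the diverging fast rows of the generator are handled. *)
Lemma l1_row_mulmx_le {m n} (v z : 'rV[R]_m) (M : 'M[R]_(m, n)) :
  (forall i, `|v 0 i| <= z 0 i) ->
  l1 (v *m M) <= \sum_i z 0 i * \sum_j `|M i j|.
Proof.
move=> vz; rewrite l1_row.
have -> : \sum_i z 0 i * \sum_j `|M i j| = \sum_j \sum_i z 0 i * `|M i j|.
  by rewrite exchange_big; apply: eq_bigr => i _; rewrite mulr_sumr.
apply: ler_sum => j _; rewrite mxE (le_trans (ler_norm_sum _ _ _))//.
by apply: ler_sum => i _; rewrite normrM ler_wpM2r.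
Qed.

Lemma l1_row_mulmx {m n} (v : 'rV[R]_m) (M : 'M[R]_(m, n)) :
  (forall i, `|v 0 i| <= 1) -> l1 (v *m M) <= l1 M.
Proof.
move=> v1; apply: le_trans (@l1_row_mulmx_le _ _ v (const_mx 1) M _) _.
  by move=> i; rewrite mxE.
by apply: ler_sum => i _; rewrite mxE mul1r.
Qed.

Lemma l1_mul_stochastic {n} (v : 'rV[R]_n) (P : 'M[R]_n) :
  stochastic_mx P -> l1 (v *m P) <= l1 v.
Proof.
move=> [P0 P1].
apply: le_trans (@l1_row_mulmx_le _ _ v (\row_i `|v 0 i|) P _) _.
  by move=> i; rewrite mxE.
rewrite l1_row; apply: ler_sum => i _; rewrite mxE.
by rewrite (eq_bigr (P i)) ?P1 ?mulr1// => j _; rewrite ger0_norm.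
Qed.

Lemma l1_cvg0 {T : Type} {F : set_system T} {FF : Filter F} {m n}
    (M : T -> 'M[R]_(m, n)) :
  (forall i j, M x i j @[x --> F] --> 0) -> l1 (M x) @[x --> F] --> 0.
Proof.
move=> M0; apply: cvg_sumr0 => i _; apply: cvg_sumr0 => j _.
by rewrite -[X in _ --> X](normr0 R); apply: cvg_norm; exact: M0.
Qed.

(* Subtracting alpha times the all-ones matrix does not change the image of a
   zero-sum row, but lowers every row sum of P by n * alpha. *)
Lemma l1_mul_doeblin {n} (alpha : R) (v : 'rV[R]_n) (P : 'M[R]_n) :
  stochastic_mx P -> (forall i j, alpha <= P i j) -> \sum_i v 0 i = 0 ->
  l1 (v *m P) <= (1 - n%:R * alpha) * l1 v.
Proof.
move=> [P0 P1] aP v0.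
have -> : v *m P = v *m (P - const_mx alpha).
  apply/rowP => j; rewrite !mxE.
  under [in RHS]eq_bigr do rewrite !mxE mulrBr.
  by rewrite sumrB -mulr_suml v0 mul0r subr0.
apply: le_trans (@l1_row_mulmx_le _ _ v (\row_i `|v 0 i|) _ _) _.
  by move=> i; rewrite mxE.
rewrite l1_row mulr_sumr; apply: ler_sum => i _; rewrite mxE mulrC.
rewrite (eq_bigr (fun j => P i j - alpha)); last first.
  by move=> j _; rewrite !mxE ger0_norm// subr_ge0.
by rewrite sumrB P1 sumr_const card_ord mulr_natl.
Qed.

End L1Norm.

Lemma sum_row_mul {R : realType} {m n} (v : 'rV[R]_m) (M : 'M[R]_(m, n)) :
  (forall i, \sum_j M i j = 1) -> \sum_j (v *m M) 0 j = \sum_i v 0 i.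
Proof.
move=> M1; under eq_bigr do rewrite mxE.
by rewrite exchange_big; apply: eq_bigr => i _; rewrite -mulr_sumr M1 mulr1.
Qed.

Section Distributions.
Context {R : realType} {n : nat}.
Implicit Types (p : 'rV[R]_n) (P : 'M[R]_n).

Lemma is_distr_mul p P : is_distr p -> stochastic_mx P -> is_distr (p *m P).
Proof.
move=> [p0 p1] [P0 P1]; split=> [j|].
  by rewrite mxE; apply: sumr_ge0 => i _; rewrite mulr_ge0.
by rewrite sum_row_mul.
Qed.

Lemma is_distr_le1 p i : is_distr p -> p 0 i <= 1.
Proof.
move=> [p0 <-]; rewrite (bigD1 i)//= lerDl.
by apply: sumr_ge0.
Qed.

End Distributions.

(** * Induction along fine subdivisions *)

Lemma near_right_subdivision {R : realType} (s : R) (p : R -> Prop) :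
  0 < s -> (\forall h \near 0^'+, p h) ->
  exists N h, [/\ 0 < h, N%:R * h = s & p h].
Proof.
move=> s0 [e /= e0 pe]; have N0 : (0 : R) < (Num.bound (s / e)).+1%:R by [].
(* Any [N] larger than [s / e] makes the mesh [s / N] smaller than [e]. *)
exists (Num.bound (s / e)).+1, (s / (Num.bound (s / e)).+1%:R).
have h0 : 0 < s / (Num.bound (s / e)).+1%:R by rewrite divr_gt0.
split=> //; first by rewrite mulrC divfK// gt_eqF.
apply: pe => //=; rewrite sub0r normrN gtr0_norm//.
rewrite ltr_pdivrMr// mulrC -ltr_pdivrMr//.
by rewrite (lt_le_trans (archi_boundP _)) ?ler_nat// ltW// divr_gt0.
Qed.

(** The condition [step] depends on [h] alone: for a time-homogeneous semigroup, a step length that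
    is good at time 0 is good everywhere, so one mesh serves all of [[0, s]]. *)
Lemma subdivision_ind {R : realType} (q step : R -> Prop) (s : R) :
  0 <= s -> q 0 -> (\forall h \near 0^'+, step h) ->
  (forall t h, 0 <= t -> 0 < h -> step h -> q t -> q (t + h)) -> q s.
Proof.
rewrite le_eqVlt => /predU1P[<-//|s0] q0 /(near_right_subdivision s0).
move=> [N [h [h0 <- ph]]] qS; elim: N => [|N IH]; first by rewrite mul0r.
by rewrite -natr1 mulrDl mul1r; apply: qS => //; rewrite mulr_ge0// ltW.
Qed.

(** * Positivity, supersolutions and contraction for a semigroup *)

Section Semigroup.
Context {R : realType} {n : nat} (P : R -> 'M[R]_n) (G : 'M[R]_n).
Hypothesis Psg : transition_semigroup P G.

Lemma semigroup_stochastic t : 0 <= t -> stochastic_mx (P t).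
Proof. by case: Psg => + _ _ _ => /[apply]. Qed.

Lemma semigroup0 : P 0 = 1%:M.
Proof. by case: Psg. Qed.

Lemma semigroupD s t : 0 <= s -> 0 <= t -> P (s + t) = P s *m P t.
Proof. by case: Psg => _ _ + _; apply. Qed.

Lemma semigroup_cvg_mull {m} (v : 'M[R]_(m, n)) i j :
  (v *m P h - v) i j / h @[h --> 0^'+] --> (v *m G) i j.
Proof.
have -> : (fun h => (v *m P h - v) i j / h) =
    fun h => \sum_k v i k * ((P h - 1%:M) k j / h).
  apply/funext => h; rewrite -{2}[v]mulmx1 -mulmxBr mxE mulr_suml.
  by apply: eq_bigr => k _; rewrite mulrA.
rewrite mxE; apply: cvg_sumr => k _.
by apply: cvgM; [exact: cvg_cst|case: Psg].
Qed.

Lemma semigroup_cvg_mulr {m} (K : 'M[R]_(n, m)) i j :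
  (P h *m K - K) i j / h @[h --> 0^'+] --> (G *m K) i j.
Proof.
have -> : (fun h => (P h *m K - K) i j / h) =
    fun h => \sum_k ((P h - 1%:M) i k / h) * K k j.
  apply/funext => h; rewrite -{2}[K]mul1mx -mulmxBl mxE mulr_suml.
  by apply: eq_bigr => k _; rewrite mulrAC.
rewrite mxE; apply: cvg_sumr => k _.
by apply: cvgM; [case: Psg|exact: cvg_cst].
Qed.

(** Where [z] is at least 1 the bound is trivial for a distribution. Elsewhere, [p *m P s <= z]
    gives [p *m P (s + h) <= z *m P h], and the strict sign of [z *m G] makes the latter at most [z]
    for small [h]. *)
Lemma semigroup_supersolution (p z : 'rV[R]_n) :
  is_distr p -> (forall j, p 0 j <= z 0 j) ->
  (forall j, 1 <= z 0 j \/ (z *m G) 0 j < 0) ->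
  forall t, 0 <= t -> forall j, (p *m P t) 0 j <= z 0 j.
Proof.
move=> pd pz zG t t0.
have near_step : \forall h \near 0^'+,
    forall j, (z *m G) 0 j < 0 -> (z *m P h - z) 0 j / h < 0.
  apply: filter_forall => j; have [zj|zj] := ltP ((z *m G) 0 j) 0.
    have zPj := cvgr_lt _ (@semigroup_cvg_mull _ z 0 j) _ zj.
    by near=> h; move=> _; near: h; exact: zPj.
  by near=> h.
apply: (subdivision_ind (q := fun t => forall j, (p *m P t) 0 j <= z 0 j)
  t0 _ near_step) => [j|s h s0 h0 hstep qs j].
  by rewrite semigroup0 mulmx1.
have [zj|zj] := zG j.
  apply: le_trans zj; apply: is_distr_le1; apply: is_distr_mul pd _.
  by apply: semigroup_stochastic; rewrite addr_ge0// ltW.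
rewrite semigroupD ?(ltW h0)// mulmxA; apply: (@le_trans _ _ ((z *m P h) 0 j)).
  rewrite !mxE; apply: ler_sum => k _; rewrite ler_wpM2r//.
  by have [+ _] := semigroup_stochastic (ltW h0).
by have := hstep j zj; rewrite pmulr_llt0 ?invr_gt0// !mxE subr_lt0 => /ltW.
Unshelve. all: by end_near. Qed.

Hypothesis n_gt0 : (0 < n)%N.

(** For small [h], [P h] is positive on the diagonal and on the edges of [G]. Paths then give
    positivity at multiples of [h], and loops pad them to a common length. *)
Lemma semigroup_positive : irreducible_rate_mx G ->
  exists2 T, 0 < T & forall i j, 0 < P T i j.
Proof.
move=> Girr.
have : \forall h \near 0^'+, forall i j,
    (i == j) || (0 < G i j) -> 0 < P h i j.
  apply: filter_forall => i; apply: filter_forall => j.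
  case: (eqVneq i j) => [<-|ij] /=; last first.
    have [Gij|Gij] := ltP 0 (G i j); last by near=> h.
    have /cvgr_gt/(_ _ Gij) : (P h - 1%:M) i j / h @[h --> 0^'+] --> G i j.
      by case: Psg.
    move=> Pij; near=> h; move=> _.
    have : 0 < (P h - 1%:M) i j / h by near: h; exact: Pij.
    rewrite !mxE (negbTE ij) subr0.
    by rewrite pmulr_lgt0// invr_gt0.
  (* On the diagonal the difference quotient eventually exceeds [G i i - 1], so [P h i i] exceeds
     [1 - h * (|G i i| + 1)], which is positive for small [h]. *)
  have /cvgr_gt/(_ (G i i - 1)) :
      (P h - 1%:M) i i / h @[h --> 0^'+] --> G i i by case: Psg.
  rewrite ltrBlDr ltrDl ltr01 => /(_ isT).
  have c0 : 0 < (`|G i i| + 1)^-1 by rewrite invr_gt0 ltr_wpDl.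
  move=> Pii; near=> h; move=> _.
  have : G i i - 1 < (P h - 1%:M) i i / h by near: h; exact: Pii.
  rewrite !mxE eqxx mulr1n ltr_pdivlMr// => Gh.
  have : h * (`|G i i| + 1) < 1.
    by rewrite -ltr_pdivlMr ?ltr_wpDl// div1r; near: h; exact: nbhs_right_lt.
  have /lerNnormlW := lexx `|G i i|; rewrite -(ler_pM2l (_ : 0 < h))//.
  move: Gh; nra.
move=> /(near_right_subdivision ltr01)[_ [h [h0 _ Ph]]].
have Pmul s t i k j : 0 <= s -> 0 <= t -> 0 < P s i k -> 0 < P t k j ->
    0 < P (s + t) i j.
  move=> s0 t0 Ps Pt; rewrite semigroupD// mxE (bigD1 k)//=.
  rewrite ltr_pwDl ?mulr_gt0// sumr_ge0// => l _.
  by have [+ _] := semigroup_stochastic s0; have [+ _] := semigroup_stochastic t0;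
    move=> ? ?; rewrite mulr_ge0.
have hN N : 0 <= N%:R * h by rewrite mulr_ge0// ltW.
have loop N i : 0 < P (N%:R * h) i i.
  elim: N => [|N IH]; first by rewrite mul0r semigroup0 mxE eqxx.
  by rewrite -natr1 mulrDl mul1r; apply: Pmul IH _; rewrite ?(ltW h0)// Ph// eqxx.
have reach i j : exists N, 0 < P (N%:R * h) i j.
  have /connectP[s + ->] := Girr i j.
  elim: s i => [|k s IH] i /=; first by move=> _; exists 0%N; exact: loop.
  move=> /andP[/andP[_ Gik]] /IH[N PN]; exists N.+1.
  rewrite -nat1r mulrDl mul1r; apply: Pmul PN => //; first exact: ltW.
  by rewrite Ph// Gik orbT.
(* The sum of all lengths is a common bound; the successor keeps the time positive. *)
pose len (ij : 'I_n * 'I_n) := sval (cid (reach ij.1 ij.2)).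
pose N := (\sum_ij len ij).+1.
exists (N%:R * h); first by rewrite mulr_gt0.
move=> i j; have lenN : (len (i, j) <= N)%N.
  by rewrite /N (bigD1 (i, j))//= leqW// leq_addr.
rewrite -(subnKC lenN) natrD mulrDl.
by apply: Pmul (loop _ j) => //; exact: (svalP (cid (reach i j))).
Unshelve. all: by end_near. Qed.

(** Doeblin's condition at a time when all entries are positive: with [alpha] the least entry of
    [P T], [rho] is [1 - n * alpha], nonnegative because rows sum to 1. *)
Lemma semigroup_contraction : irreducible_rate_mx G ->
  exists T rho, [/\ 0 < T, 0 <= rho, rho < 1 &
    forall v : 'rV[R]_n, \sum_i v 0 i = 0 -> l1 (v *m P T) <= rho * l1 v].
Proof.
move=> /semigroup_positive[T T0 PT].
have PTs := semigroup_stochastic (ltW T0).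
pose i0 := Ordinal n_gt0.
pose m := [arg min_(ij < (i0, i0)) P T ij.1 ij.2]%O.
have mP i j : P T m.1 m.2 <= P T i j.
  rewrite /m; case: arg_minP => // ij _ /(_ (i, j) isT).
  exact.
exists T, (1 - n%:R * P T m.1 m.2); split=> //.
- have [_ P1] := PTs; rewrite subr_ge0 -[leRHS](P1 i0).
  rewrite mulr_natl -[X in _ *+ X]card_ord -sumr_const.
  by apply: ler_sum => j _; exact: mP.
- by rewrite ltrBlDr ltrDl mulr_gt0// ltr0n.
- by move=> v v0; apply: l1_mul_doeblin.
Qed.

End Semigroup.

(** * Comparison of two semigroups through a matrix [K] *)

Section Comparison.
Context {R : realType} {n m : nat}.
Variables (P : R -> 'M[R]_n) (G : 'M[R]_n) (S : R -> 'M[R]_m) (L : 'M[R]_m).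
Variables (K : 'M[R]_(n, m)) (p z : 'rV[R]_n).
Hypotheses (Psg : transition_semigroup P G) (Ssg : transition_semigroup S L).
Hypotheses (pd : is_distr p).
Hypothesis pz : forall t, 0 <= t -> forall i, (p *m P t) 0 i <= z 0 i.

(** Weighted defect of the relation [G *m K = K *m L], under which [K] would intertwine the two
    semigroups exactly. *)
Let err := \sum_i z 0 i * \sum_j `|(G *m K - K *m L) i j|.

(* Duhamel's formula for intertwining the two semigroups by K, obtained by
   telescoping over a subdivision rather than by integrating. *)
Lemma intertwining_bound u s : 0 <= u -> 0 <= s ->
  l1 (p *m P (u + s) *m K - p *m P u *m K *m S s) <= s * err.
Proof.
move=> u0 s0; apply/ler_addgt0Pr => e e0.
have [->|sn0] := eqVneq s 0.
  rewrite addr0 (semigroup0 Ssg) mulmx1 subrr l1_0 mul0r add0r.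
  exact: ltW.
have {sn0}sp : 0 < s by rewrite lt_neqAle eq_sym sn0.
(* [D h] is the gap between the difference quotient of the defect and its limit. *)
pose D h := h^-1 *: (P h *m K - K *m S h) - (G *m K - K *m L).
have Dcvg : l1 (D h) @[h --> 0^'+] --> 0.
  apply: l1_cvg0 => i j.
  have -> : (fun h => D h i j) = fun h =>
      ((P h *m K - K) i j / h - (K *m S h - K) i j / h) -
      ((G *m K) i j - (K *m L) i j).
    by apply/funext => h; rewrite /D !mxE; ring.
  rewrite -[X in _ --> X](subrr ((G *m K) i j - (K *m L) i j)).
  apply: cvgB; last exact: cvg_cst.
  by apply: cvgB; [exact: semigroup_cvg_mulr|exact: semigroup_cvg_mull].
have near_step : \forall h \near 0^'+, l1 (D h) < e / s.
  by apply: (cvgr_lt _ Dcvg); rewrite divr_gt0.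
(* The slack rate [e / s] absorbs [D h] and adds up to [e] over [[0, s]]. *)
suff : l1 (p *m P (u + s) *m K - p *m P u *m K *m S s) <= s * (err + e / s).
  by rewrite mulrDr [s * (e / s)]mulrC divfK// gt_eqF.
apply: (subdivision_ind (q := fun t =>
  l1 (p *m P (u + t) *m K - p *m P u *m K *m S t) <= t * (err + e / s))
  s0 _ near_step) => [|t h t0 h0 hD IH].
  by rewrite addr0 (semigroup0 Ssg) mulmx1 subrr l1_0 mul0r.
(* The old error is carried along by [S h], which does not increase it; the other term is the defect
   created during the new step. *)
have -> : p *m P (u + (t + h)) *m K - p *m P u *m K *m S (t + h) =
    (p *m P (u + t) *m K - p *m P u *m K *m S t) *m S h +
    p *m P (u + t) *m (P h *m K - K *m S h).
  rewrite addrA (semigroupD Psg (addr_ge0 u0 t0) (ltW h0)).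
  rewrite (semigroupD Ssg t0 (ltW h0)).
  by rewrite mulmxBl mulmxBr !mulmxA [RHS]addrC addrA subrK.
have put : is_distr (p *m P (u + t)).
  by apply: is_distr_mul pd _; apply: (semigroup_stochastic Psg); rewrite addr_ge0.
have -> : P h *m K - K *m S h = h *: ((G *m K - K *m L) + D h).
  by rewrite /D [X in _ *: X]addrC subrK scalerA divff ?scale1r// gt_eqF.
rewrite mulrDl (le_trans (l1D _ _))// lerD//.
  by rewrite (le_trans (l1_mul_stochastic _ (semigroup_stochastic Ssg (ltW h0)))).
rewrite -scalemxAr l1Z gtr0_norm// ler_pM2l// mulmxDr (le_trans (l1D _ _))//.
apply: lerD.
  apply: l1_row_mulmx_le => i; rewrite ger0_norm; last by case: put.
  by apply: pz; rewrite addr_ge0.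
apply: le_trans (ltW hD); apply: l1_row_mulmx => i.
by rewrite ger0_norm; [exact: is_distr_le1|case: put].
Qed.

(** Each block of length [T] adds at most [T * err] and contracts the earlier error, a zero-sum row,
    by [rho]. The bound is the fixed point of [e = T * err + rho * e]. *)
Lemma intertwining_bound_uniform T rho :
  0 < T -> 0 <= rho -> rho < 1 ->
  (forall v : 'rV[R]_m, \sum_i v 0 i = 0 -> l1 (v *m S T) <= rho * l1 v) ->
  (forall i, \sum_j K i j = 1) ->
  forall t, 0 <= t ->
  l1 (p *m P t *m K - p *m K *m S t) <= T * err / (1 - rho).
Proof.
move=> T0 rho0 rho1 contr K1 t t0.
have err0 : 0 <= err.
  apply: sumr_ge0 => i _; rewrite mulr_ge0 ?sumr_ge0//.
  apply: le_trans (pz (lexx 0) i).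
  by have [+ _] := is_distr_mul pd (semigroup_stochastic Psg (lexx 0)).
have rho1' : 0 < 1 - rho by rewrite subr_gt0.
have sum0 u : 0 <= u ->
    \sum_i (p *m P u *m K - p *m K *m S u) 0 i = 0.
  move=> u0.
  have [_ S1] := semigroup_stochastic Ssg u0.
  have [_ P1] := semigroup_stochastic Psg u0.
  transitivity (\sum_i (p *m P u *m K) 0 i - \sum_i (p *m K *m S u) 0 i).
    by rewrite -sumrB; apply: eq_bigr => i _; rewrite mxE [X in _ + X]mxE.
  by rewrite !sum_row_mul// subrr.
(* Within the first block no contraction is called for, since [1 - rho <= 1]. *)
have short u : 0 <= u -> u <= T ->
    l1 (p *m P u *m K - p *m K *m S u) <= T * err / (1 - rho).
  move=> u0 uT; have := intertwining_bound (lexx 0) u0.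
  rewrite add0r (semigroup0 Psg) mulmx1 => /le_trans; apply.
  rewrite ler_pdivlMr// -mulrA ler_pM//; first exact: mulr_ge0 err0 (ltW _).
  by rewrite ler_piMr// lerBlDr lerDl.
have long k u : 0 <= u -> u <= T ->
    l1 (p *m P (u + k%:R * T) *m K - p *m K *m S (u + k%:R * T))
    <= T * err / (1 - rho).
  move=> u0 uT; elim: k => [|k IH]; first by rewrite mul0r addr0 short.
  rewrite -natr1 mulrDl mul1r addrA; set w := u + _ in IH *.
  have w0 : 0 <= w by rewrite addr_ge0// mulr_ge0// ltW.
  have -> : p *m P (w + T) *m K - p *m K *m S (w + T) =
      (p *m P (w + T) *m K - p *m P w *m K *m S T) +
      (p *m P w *m K - p *m K *m S w) *m S T.
    by rewrite (semigroupD Ssg w0 (ltW T0)) mulmxBl !mulmxA addrA subrK.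
  rewrite (le_trans (l1D _ _))//.
  have -> : T * err / (1 - rho) = T * err + rho * (T * err / (1 - rho)).
    by field; rewrite gt_eqF.
  apply: lerD; first exact: intertwining_bound (ltW T0).
  by rewrite (le_trans (contr _ (sum0 _ w0)))// ler_wpM2l.
(* A general [t] is a whole number of blocks after a remainder in [[0, T]]. *)
have tT0 : 0 <= t / T by rewrite divr_ge0// ltW.
have /andP[kt tk] := truncn_itv tT0.
have -> : t = (t - (Num.truncn (t / T))%:R * T) + (Num.truncn (t / T))%:R * T.
  by rewrite subrK.
apply: long; first by rewrite subr_ge0 -ler_pdivlMr.
by move: tk; rewrite -natr1 ltr_pdivrMr// mulrDl mul1r lerBlDl => /ltW.
Qed.

End Comparison.

(** * From processes to matrices *)

(** The two-point distribution at times 0 and [t], summed over the initial state. *)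
Lemma law_ctmc {R : realType} {n : nat} {d} {T : measurableType d}
    (P : probability T R) (X : R -> T -> 'I_n) (init : 'rV[R]_n)
    (G : 'M[R]_n) : is_ctmc P X init G ->
  exists2 Pt, transition_semigroup Pt G &
    forall t, 0 <= t -> law P (X t) = init *m Pt t.
Proof.
move=> [mX [Pt Ptsg fdd]]; exists Pt => // t t0.
apply/rowP => j; rewrite !mxE.
pose tt (k : nat) := if k is 0%N then 0 else t.
pose ss i (k : nat) := if k is 0%N then i else j.
pose F i := [set w | forall k, (k <= 1)%N -> X (tt k) w = ss i k].
have FE i : F i = X 0 @^-1` [set i] `&` X t @^-1` [set j].
  apply/seteqP; split=> w /= => [Fw|[X0 Xt] [|[|//]]//].
  by split; [exact: (Fw 0%N)|exact: (Fw 1%N)].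
have -> : X t @^-1` [set j] = \bigcup_(i in [set` index_enum 'I_n]) F i.
  apply/seteqP; split=> w /=; last by move=> [i _]; rewrite FE => -[].
  by move=> Xt; exists (X 0 w); rewrite ?FE //= mem_index_enum.
rewrite measure_fin_bigcup; first last.
- by move=> i _; rewrite FE; apply: measurableI; apply: mX.
- by move=> i k _ _ [w]; rewrite !FE => -[[/= <- _] [/= <- _]].
- exact: finite_seq.
rewrite -fsbig_seq ?index_enum_uniq//=.
rewrite (eq_bigr (fun i => (init 0 i * Pt t i j)%:E)); last first.
  move=> i _; rewrite /F fdd//; first by rewrite big_ord1 /= subr0.
  by apply/nondecreasing_seqP => -[|k] /=.
by rewrite sumEFin.
Qed.

(** Hitting [B] is the countable union, over finite words ending in [B], of the events that the
    chain follows the word. Without a positive path to [B] all of these would be null. *)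
Lemma dtmc_hit_path {R : realType} {n : nat} {d} {T : measurableType d}
    (P : probability T R) (eta : nat -> T -> 'I_n) (i : 'I_n) (W : 'M[R]_n)
    (B : set 'I_n) :
  (forall x y, 0 <= W x y) -> is_dtmc P eta (delta_mx 0 i) W ->
  P [set w | (hitting_time (R := R) eta B w < +oo)%E] = 1%E ->
  exists2 s, path (fun x y => 0 < W x y) i s & B (last i s).
Proof.
move=> W0 [meta fdd] hit1; apply: contrapT => nopath.
(* The default value of [nth] makes the empty word behave like the one-letter word [i]. *)
pose F (u : seq 'I_n) := [set w | B (nth i u (size u).-1) /\
  forall k, (k <= (size u).-1)%N -> eta k w = nth i u k].
have mF u : measurable (F u).
  have [Bu|Bu] := pselect (B (nth i u (size u).-1)); last first.
    by rewrite (_ : F u = set0)//; apply/seteqP; split=> w // -[].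
  rewrite (_ : F u = \bigcap_(k in `I_((size u).-1).+1)
      eta k @^-1` [set nth i u k]).
    by apply: fin_bigcap_measurable => // k _; exact: meta.
  apply/seteqP; split=> w /=; first by move=> [_ h] k /= ku; exact: h.
  by move=> h; split=> // k ku; exact: h.
have PF u : P (F u) = 0%E.
  have [Bu|Bu] := pselect (B (nth i u (size u).-1)); last first.
    by rewrite (_ : F u = set0) ?measure0//; apply/seteqP; split=> w // -[].
  rewrite (_ : F u = [set w | forall k, (k <= (size u).-1)%N ->
      eta k w = nth i u k]); last first.
    by apply/seteqP; split=> w //= -[].
  rewrite fdd; have [u0|] := eqVneq (nth i u 0) i; last first.
    by move=> /negbTE ui; rewrite mxE eqxx ui mul0r.
  have [->|] := eqVneq (\prod_(k < (size u).-1) W (nth i u k) (nth i u k.+1)) 0.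
    by rewrite mulr0.
  move=> /prodf_neq0 Wpos; case: nopath; exists (behead u); last first.
    suff -> : last i (behead u) = nth i u (size u).-1 by [].
    by case: u u0 {Bu Wpos} => [|x u] //= ->; rewrite -last_nth.
  case: u u0 Wpos {Bu} => //= x u -> Wpos.
  apply/(pathP i) => k ku; rewrite lt_neqAle W0 andbT eq_sym.
  by have := Wpos (Ordinal ku) isT.
(* An enumeration of the words turns the union into one indexed by integers. *)
have [e eK] : exists e : nat -> option (seq 'I_n),
    forall u, exists m, e m = Some u.
  by exists unpickle => u; exists (pickle u); exact: pickleK.
have hitE : [set w | (hitting_time (R := R) eta B w < +oo)%E] =
    \bigcup_m oapp F set0 (e m).
  apply/seteqP; split=> w /=.
    move=> hitw; have [k Bk] : exists k, B (eta k w).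
      apply: contrapT => nohit; move: hitw; rewrite /hitting_time.
      rewrite (_ : [set k | _] = set0) ?image_set0 ?ereal_inf0 ?ltxx//.
      by apply/seteqP; split=> k // Bk; case: nohit; exists k.
    have [u su etau] : exists2 u, size u = k.+1 &
        forall l, (l <= k)%N -> eta l w = nth i u l.
      exists (mkseq (eta^~ w) k.+1); first by rewrite size_mkseq.
      by move=> l lk; rewrite nth_mkseq.
    have [m em] := eK u; exists m => //.
    by rewrite em /F /= su /=; split=> //; rewrite -etau.
  move=> [m _]; case: (e m) => //= u [Bu etau].
  apply: (@le_lt_trans _ _ ((size u).-1%:R)%:E); last exact: ltry.
  apply: ereal_inf_lbound; exists (size u).-1 => //=.
  by rewrite etau.
move: hit1; rewrite hitE measure_negligible.
  by move/eqP; rewrite eq_sym onee_eq0.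
  by apply: bigcup_measurable => m _; case: (e m) => [u|] /=; [exact: mF|].
apply: negligible_bigcup => m; case: (e m) => [u|]/=; last exact: negligible_set0.
by apply/negligibleP; [exact: mF|exact: PF].
Qed.

(** * Minimum principle and inversion of the fast block *)

(** A negative minimum is attained off [B] and propagates to every successor, hence along a path
    into [B], where [y] is nonnegative. *)
Lemma minimum_principle {R : realType} {n : nat} (W : 'M[R]_n)
    (B : set 'I_n) (y : 'I_n -> R) :
  (forall i j, 0 <= W i j) -> (forall i, ~ B i -> \sum_j W i j = 1) ->
  (forall i, ~ B i ->
    exists2 s, path (fun x y => 0 < W x y) i s & B (last i s)) ->
  (forall i, B i -> 0 <= y i) ->
  (forall i, ~ B i -> \sum_j W i j * y j <= y i) ->
  forall i, 0 <= y i.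
Proof.
move=> W0 W1 Wpath yB yW i1.
pose m := [arg min_(i < i1) y i]%O.
have ym i : y m <= y i.
  by rewrite /m; case: arg_minP => // k _ /(_ i isT).
apply: le_trans (ym i1); rewrite leNgt; apply/negP => m0.
have step i j : y i = y m -> 0 < W i j -> y j = y m.
  move=> yi Wij.
  have Bi : ~ B i by move=> /yB; rewrite yi leNgt m0.
  (* An average of the nonnegative [y k - y m] that is at most 0 vanishes term by term. *)
  have le0 : \sum_k W i k * (y k - y m) <= 0.
    under eq_bigr do rewrite mulrBr.
    by rewrite sumrB -mulr_suml W1// mul1r subr_le0 -yi yW.
  have ge0 k : 0 <= W i k * (y k - y m) by rewrite mulr_ge0// subr_ge0.
  have /eqP : W i j * (y j - y m) = 0.
    apply/eqP; rewrite eq_le ge0 andbT; apply: le_trans le0.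
    by rewrite (bigD1 j)//= lerDl sumr_ge0.
  by rewrite mulf_eq0 gt_eqF//= subr_eq0 => /eqP.
have walk s i : y i = y m -> path (fun x y => 0 < W x y) i s ->
    y (last i s) = y m.
  by elim: s i => //= k s IH i yi /andP[/(step _ _ yi)]; exact: IH.
have [Bm|Bm] := pselect (B m); first by have := yB _ Bm; rewrite leNgt m0.
have [s ms Bs] := Wpath _ Bm.
by have := yB _ Bs; rewrite (walk _ _ erefl ms) leNgt m0.
Qed.

Section FastBlock.
Context {R : realType} {a b : nat} (W : 'M[R]_(a + b)).
Hypothesis W0 : forall i j, 0 <= W i j.
Hypothesis W1 : forall i, \sum_j W (lshift b i) j = 1.
Hypothesis Wpath : forall i, exists2 s,
  path (fun x y => 0 < W x y) (lshift b i) s & (a <= last (lshift b i) s)%N.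

(** The minimum principle for [y] extended by 0 to the slow states. *)
Lemma fast_block_monotone (y : 'cV[R]_a) :
  (forall i, 0 <= ((1%:M - ulsubmx W) *m y) i 0) -> forall i, 0 <= y i 0.
Proof.
move=> yW i; pose f k := col_mx y (0 : 'cV[R]_b) k 0.
suff /(_ (lshift b i)) : forall k, 0 <= f k by rewrite /f col_mxEu.
pose B : set 'I_(a + b) := [set k | (a <= k)%N].
have fast k : ~ B k -> exists j, k = lshift b j.
  case: (split_ordP k) => j -> /=; first by exists j.
  by rewrite /B /= leq_addr.
apply: (@minimum_principle _ _ W B) => //.
- by move=> _ /fast[k ->].
- by move=> _ /fast[k ->].
- move=> k; case: (split_ordP k) => j ->; rewrite /B /=.
    by rewrite leqNgt ltn_ord.
  by rewrite /f col_mxEd mxE.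
- move=> _ /fast[k ->]; rewrite big_split_ord /= [leRHS]/f col_mxEu.
  under [X in _ + X]eq_bigr do rewrite /f col_mxEd mxE mulr0.
  rewrite big1_eq addr0 -subr_ge0; have := yW k.
  rewrite mulmxBl mul1mx !mxE; congr (_ <= _ - _).
  by apply: eq_bigr => j _; rewrite /f col_mxEu !mxE.
Qed.

Lemma fast_block_unit : 1%:M - ulsubmx W \in unitmx.
Proof.
(* [det0P] yields a row in the left kernel, hence the transpose; monotonicity for both signs of that
   vector forces it to be 0. *)
rewrite -unitmx_tr unitmxE unitfE; apply/negP => /det0P[v v0 vW].
have Wv : (1%:M - ulsubmx W) *m v^T = 0.
  by apply: trmx_inj; rewrite trmx_mul trmxK vW trmx0.
case/eqP: v0; apply/rowP => i; rewrite mxE; apply/eqP; rewrite eq_le.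
apply/andP; split.
  have := @fast_block_monotone (- v^T) _ i; rewrite !mxE oppr_ge0; apply=> k.
  by rewrite mulmxN Wv oppr0 mxE.
by have := @fast_block_monotone v^T _ i; rewrite mxE; apply=> k; rewrite Wv mxE.
Qed.

Lemma fast_block_inv_ge0 i j : 0 <= invmx (1%:M - ulsubmx W) i j.
Proof.
have := @fast_block_monotone (col j (invmx (1%:M - ulsubmx W))) _ i.
rewrite mxE; apply=> k.
rewrite colE mulmxA mulmxV ?fast_block_unit// mul1mx !mxE.
by rewrite ler0n.
Qed.

End FastBlock.

Lemma fin_num_cvg {R : realType} {T : Type} {F : set_system T} {FF : Filter F}
    (f : T -> R) (l : \bar R) : l \is a fin_num ->
  (f x)%:E @[x --> F] --> l -> f x @[x --> F] --> fine l.
Proof. by case: l => // l _ /fine_cvg. Qed.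

(** * Limits of rates and of jump probabilities *)

Section RateLimits.
Context {R : realType} {n : nat} (Q : R -> 'M[R]_n).
Hypothesis Qrate : forall l, 0 < l -> rate_mx (Q l).
Hypothesis Qlim : forall i j : 'I_n, i != j ->
  cvg ((Q l i j)%:E @[l --> +oo%R]).
Hypothesis jump_lim : forall i j : 'I_n, i != j ->
  cvg (jump_mx (Q l) i j @[l --> +oo%R]).

Lemma exit_rateE l i : 0 < l ->
  exit_rate (Q l) i = \sum_(j | j != i) Q l i j.
Proof.
move=> /Qrate[_ /(_ i)]; rewrite (bigD1 i)//= => /eqP.
by rewrite addrC addr_eq0 => /eqP ->.
Qed.

Lemma near_pinfty_gt0 : \forall l \near +oo%R, (0 : R) < l.
Proof. exact: nbhs_pinfty_gt. Qed.

Lemma lim_rate_cvg i j : i != j ->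
  (Q l i j)%:E @[l --> +oo%R] --> lim_rate Q i j.
Proof. exact: Qlim. Qed.

Lemma near_rate_ge0 i j : i != j ->
  \forall l \near +oo%R, (0 <= (Q l i j)%:E)%E.
Proof.
move=> ij; near=> l; rewrite lee_fin.
have l0 : 0 < l by near: l; exact: near_pinfty_gt0.
by have [+ _] := Qrate l0; apply.
Unshelve. all: by end_near. Qed.

Lemma lim_rate_ge0 i j : i != j -> (0 <= lim_rate Q i j)%E.
Proof. by move=> ij; apply: lime_ge (Qlim ij) (near_rate_ge0 ij). Qed.

(** Nonnegative off-diagonal rates exclude indeterminate sums, so infinite limits are allowed. *)
Lemma exit_rate_cvg_sum i :
  (exit_rate (Q l) i)%:E @[l --> +oo%R] --> (\sum_(j | j != i) lim_rate Q i j)%E.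
Proof.
have : (\sum_(j | j != i) (Q l i j)%:E)%E @[l --> +oo%R] -->
    (\sum_(j | j != i) lim_rate Q i j)%E.
  apply: cvg_nnesum => j ji; first by apply: near_rate_ge0; rewrite eq_sym.
  by apply: lim_rate_cvg; rewrite eq_sym.
apply: cvg_trans; apply: near_eq_cvg; near=> l.
by rewrite exit_rateE ?sumEFin.
Unshelve. all: by end_near. Qed.

Lemma lim_exit_rateE i : lim_exit_rate Q i = (\sum_(j | j != i) lim_rate Q i j)%E.
Proof. exact/cvg_lim/exit_rate_cvg_sum. Qed.

Lemma exit_rate_cvg i :
  (exit_rate (Q l) i)%:E @[l --> +oo%R] --> lim_exit_rate Q i.
Proof. by rewrite lim_exit_rateE; exact: exit_rate_cvg_sum. Qed.

Lemma lim_exit_rate_ge0 i : (0 <= lim_exit_rate Q i)%E.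
Proof.
rewrite lim_exit_rateE; apply: sume_ge0 => j ji.
by apply: lim_rate_ge0; rewrite eq_sym.
Qed.

Lemma fast_exit_rate_cvg i : fast_states Q i ->
  exit_rate (Q l) i @[l --> +oo%R] --> +oo%R.
Proof. by move=> fi; apply/cvgeryP; have := exit_rate_cvg (i := i); rewrite fi. Qed.

Lemma fast_exit_rate_gt0 i : fast_states Q i ->
  \forall l \near +oo%R, 0 < exit_rate (Q l) i.
Proof. by move=> /fast_exit_rate_cvg /cvgryPgt. Qed.

(** Each off-diagonal limit is at most the finite limiting exit rate, so [fine] loses nothing in
    slow rows. *)
Lemma slow_rate_cvg i j : slow_states Q i ->
  Q l i j @[l --> +oo%R] --> lim_rate_mx Q i j.
Proof.
move=> si; have exit_fin : lim_exit_rate Q i \is a fin_num.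
  by rewrite ge0_fin_numE ?lim_exit_rate_ge0.
have [<-|ij] := eqVneq i j.
  have QiE : (fun l => (Q l i i)%:E) = fun l => (- (exit_rate (Q l) i)%:E)%E.
    by apply/funext => l; rewrite /exit_rate -EFinN opprK.
  have Qi : (Q l i i)%:E @[l --> +oo%R] --> (- lim_exit_rate Q i)%E.
    by rewrite QiE; apply: cvgeN; exact: exit_rate_cvg.
  rewrite mxE /lim_rate (cvg_lim _ Qi)//.
  by apply: fin_num_cvg; rewrite ?fin_numN.
have lim_fin : lim_rate Q i j \is a fin_num.
  rewrite ge0_fin_numE ?lim_rate_ge0//; apply: le_lt_trans si.
  rewrite lim_exit_rateE (bigD1 j) ?(eq_sym j)//= leeDl// sume_ge0// => k.
  by move=> /andP[ki _]; rewrite lim_rate_ge0// eq_sym.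
by rewrite mxE; apply: fin_num_cvg => //; exact: lim_rate_cvg.
Qed.

Lemma jump_cvg i j : jump_mx (Q l) i j @[l --> +oo%R] --> lim_jump_mx Q i j.
Proof.
rewrite mxE; have [<-|] := eqVneq i j; last exact: jump_lim.
have -> : (fun l => jump_mx (Q l) i i) = fun=> 0.
  by apply/funext => l; rewrite mxE eqxx.
exact: is_cvg_cst.
Qed.

Lemma lim_jump_ge0 i j : 0 <= lim_jump_mx Q i j.
Proof.
rewrite -(cvg_lim _ (jump_cvg (i := i) (j := j)))//; apply: limr_ge.
  exact: cvgP (jump_cvg (i := i) (j := j)).
near=> l; have l0 : 0 < l by near: l; exact: near_pinfty_gt0.
rewrite mxE; case: eqVneq => // ij; have [Q0 _] := Qrate l0.
rewrite divr_ge0 ?Q0// exit_rateE// sumr_ge0// => k ki.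
by rewrite Q0// eq_sym.
Unshelve. all: by end_near. Qed.

(** Normalized fast rows tend to those of [W - I]: the diagonal ratio is [-1], whereas [jump_mx] has
    a zero diagonal. *)
Lemma fast_rate_ratio_cvg i j : fast_states Q i ->
  Q l i j / exit_rate (Q l) i @[l --> +oo%R] -->
  lim_jump_mx Q i j - (i == j)%:R.
Proof.
move=> fi; have ei_near := fast_exit_rate_gt0 fi.
have [<-|ij] := eqVneq i j; last first.
  rewrite subr0; have := jump_cvg (i := i) (j := j).
  by under eq_fun do rewrite mxE (negbTE ij).
have -> : lim_jump_mx Q i i = 0.
  rewrite mxE; apply: cvg_lim => //.
  by under eq_fun do rewrite mxE eqxx; exact: cvg_cst.
rewrite sub0r; apply: cvg_near_cst; near=> l.
have -> : Q l i i = - exit_rate (Q l) i by rewrite opprK.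
by rewrite mulNr divff// gt_eqF//; near: l; exact: ei_near.
Unshelve. all: by end_near. Qed.

Lemma fast_exit_rateV_cvg0 i : fast_states Q i ->
  (exit_rate (Q l) i)^-1 @[l --> +oo%R] --> 0.
Proof.
move=> fi; apply/gtr0_cvgV0; first exact: fast_exit_rate_gt0.
exact: fast_exit_rate_cvg.
Qed.

(** Rows of a rate matrix sum to 0, hence so do the limiting rows of [W - I]. *)
Lemma lim_jump_sum1 i : fast_states Q i -> \sum_j lim_jump_mx Q i j = 1.
Proof.
move=> fi; apply/eqP; rewrite -subr_eq0; apply/eqP.
have <- : \sum_j (lim_jump_mx Q i j - (i == j)%:R) =
    \sum_j lim_jump_mx Q i j - 1.
  rewrite sumrB; congr (_ - _); rewrite (bigD1 i)//= eqxx big1 ?addr0// => j.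
  by rewrite eq_sym => /negbTE ->.
have : \sum_j Q l i j / exit_rate (Q l) i @[l --> +oo%R] -->
    \sum_j (lim_jump_mx Q i j - (i == j)%:R).
  by apply: cvg_sumr => j _; exact: fast_rate_ratio_cvg.
move=> /cvg_lim <-//; apply: cvg_lim => //; apply: cvg_near_cst; near=> l.
have l0 : 0 < l by near: l; exact: near_pinfty_gt0.
by rewrite -mulr_suml; have [_ ->] := Qrate l0; rewrite mul0r.
Unshelve. all: by end_near. Qed.

End RateLimits.

Lemma dTV_ge0 {R : realType} {n} (mu nu : 'rV[R]_n) : 0 <= dTV mu nu.
Proof. by rewrite mulr_ge0 ?invr_ge0// sumr_ge0. Qed.

(** * The total variation bound at a fixed parameter *)

Section FixedParameter.
Context {R : realType} {a b : nat}.
Variables (P : R -> 'M[R]_(a + b)) (G : 'M[R]_(a + b)).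
Variables (S : R -> 'M[R]_b) (L : 'M[R]_b) (H : 'M[R]_(a, b)).
Variables (mu : 'rV[R]_b) (zA : 'rV[R]_a).
Hypotheses (Psg : transition_semigroup P G) (Ssg : transition_semigroup S L).
Hypotheses (mu_distr : is_distr mu) (H1 : forall i, \sum_j H i j = 1).

Let K := col_mx H (1%:M : 'M[R]_b).
Let z := row_mx zA (const_mx 1 : 'rV[R]_b).

Hypotheses (zA0 : forall i, 0 <= zA 0 i)
  (zG : forall i, (z *m G) 0 (lshift b i) < 0).

Lemma extend0_distr : is_distr (extend0 mu : 'rV[R]_(a + b)).
Proof.
have [mu0 mu1] := mu_distr; split=> [k|].
  by case: (split_ordP k) => j ->; rewrite ?row_mxEl ?row_mxEr ?mxE.
rewrite big_split_ord /= -[RHS]mu1 big1 ?add0r => [|j _].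
  by apply: eq_bigr => j _; rewrite row_mxEr.
by rewrite row_mxEl mxE.
Qed.

(** The first sum bounds the fast mass. On the slow states [p] equals [p *m K] minus the fast part
    of [p] times [H], which gives the other two terms. *)
Lemma dTV_semigroups_le T rho t : 0 < T -> 0 <= rho -> rho < 1 ->
  (forall v : 'rV[R]_b, \sum_i v 0 i = 0 -> l1 (v *m S T) <= rho * l1 v) ->
  0 <= t ->
  dTV (extend0 mu *m P t) (extend0 (mu *m S t)) <=
  \sum_i zA 0 i +
  (T * (\sum_i z 0 i * \sum_j `|(G *m K - K *m L) i j|) / (1 - rho) +
   \sum_i zA 0 i * \sum_j `|H i j|).
Proof.
move=> T0 rho0 rho1 contr t0; set p := extend0 mu *m P t.
have mux : is_distr (extend0 mu : 'rV_(a + b)) by exact: extend0_distr.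
have pz s : 0 <= s -> forall i, (extend0 mu *m P s) 0 i <= z 0 i.
  apply: (semigroup_supersolution Psg mux) => k.
    case: (split_ordP k) => j ->; first by rewrite !row_mxEl mxE.
    by rewrite !row_mxEr mxE is_distr_le1.
  case: (split_ordP k) => j ->; first by right.
  by left; rewrite row_mxEr mxE.
have K1 i : \sum_j K i j = 1.
  case: (split_ordP i) => k ->.
    by under eq_bigr do rewrite col_mxEu.
  under eq_bigr do rewrite col_mxEd mxE.
  by rewrite (bigD1 k)//= eqxx big1 ?addr0// => j; rewrite eq_sym => /negbTE ->.
have muK : extend0 mu *m K = mu.
  by rewrite mul_row_col mul0mx add0r mulmx1.
have := intertwining_bound_uniform Psg Ssg mux pz T0 rho0 rho1 contr K1 t0.
rewrite muK -/p; set bnd := _ / _ => dle.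
have pA i : `|(lsubmx p) 0 i| <= zA 0 i.
  have [p0 _] : is_distr p := is_distr_mul mux (semigroup_stochastic Psg t0).
  rewrite mxE ger0_norm//; apply: le_trans (pz _ t0 _) _.
  by rewrite row_mxEl.
have pB : \sum_j `|p 0 (rshift a j) - (mu *m S t) 0 j| <=
    bnd + \sum_i zA 0 i * \sum_j `|H i j|.
  have -> : \sum_j `|p 0 (rshift a j) - (mu *m S t) 0 j| =
      l1 ((p *m K - mu *m S t) - lsubmx p *m H).
    have -> : p *m K - mu *m S t - lsubmx p *m H = rsubmx p - mu *m S t.
      rewrite -{1}[p]hsubmxK mul_row_col mulmx1 addrAC.
      by rewrite [X in X - _ - _]addrC addrK.
    by rewrite l1_row; apply: eq_bigr => j _; rewrite !mxE.
  apply: le_trans (l1D _ _) _; rewrite l1N; apply: lerD => //.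
  exact: l1_row_mulmx_le.
(* The factor [2^-1] of [dTV] is simply bounded by 1. *)
apply: (@le_trans _ _ (\sum_k `|p 0 k - extend0 (mu *m S t) 0 k|)).
  by rewrite ler_piMl ?sumr_ge0// invf_le1// ler1n.
rewrite big_split_ord /=; apply: lerD.
  apply: ler_sum => i _; rewrite row_mxEl [X in _ - X]mxE subr0.
  by have := pA i; rewrite mxE.
by under eq_bigr do rewrite row_mxEr.
Qed.

End FixedParameter.

(** * Passage to the limit in the parameter *)

Section Main.
Context {R : realType} {a b : nat} (Q : R -> 'M[R]_(a + b)).
Hypothesis Qrate : forall l, 0 < l -> rate_mx (Q l).
Hypothesis Qlim : forall i j : 'I_(a + b), i != j ->
  cvg ((Q l i j)%:E @[l --> +oo%R]).
Hypothesis fastE : fast_states Q = [set i : 'I_(a + b) | (i < a)%N].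
Hypothesis jump_lim : forall i j : 'I_(a + b), i != j ->
  cvg (jump_mx (Q l) i j @[l --> +oo%R]).
Hypothesis jump_path : forall i, fast_states Q i -> exists2 s,
  path (fun x y => 0 < lim_jump_mx Q x y) i s & slow_states Q (last i s).

Let W := lim_jump_mx Q.
Let N := invmx (1%:M - ulsubmx W).
Let H := N *m ursubmx W.
Let K := col_mx H (1%:M : 'M[R]_b).
Let L := reduced_rate_mx Q.

Lemma lshift_fast i : fast_states Q (lshift b i).
Proof. by rewrite fastE /= ltn_ord. Qed.

Lemma slowE k : slow_states Q k <-> (a <= k)%N.
Proof.
have -> : slow_states Q k <-> ~ fast_states Q k.
  by rewrite /slow_states /fast_states /= ltey; split=> /eqP.
by rewrite fastE /= [(a <= k)%N]leqNgt; split=> /negP.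
Qed.

Lemma rshift_slow j : slow_states Q (rshift a j).
Proof. by apply/slowE; rewrite /= leq_addr. Qed.

Let W0 i j : 0 <= W i j.
Proof. exact: lim_jump_ge0. Qed.

Let W1 i : \sum_j W (lshift b i) j = 1.
Proof. by apply: lim_jump_sum1 => //; exact: lshift_fast. Qed.

Let Wpath i : exists2 s,
  path (fun x y => 0 < W x y) (lshift b i) s & (a <= last (lshift b i) s)%N.
Proof. by have [s ? /slowE ?] := jump_path (lshift_fast i); exists s. Qed.

Let Nunit : 1%:M - ulsubmx W \in unitmx.
Proof. exact: fast_block_unit. Qed.

(** Stochasticity of the fast rows says that [1 - W_AA] and [W_AB] send the constant 1 to the same
    column. *)
Lemma exit_law_sum1 i : \sum_j H i j = 1.
Proof.
have : H *m (const_mx 1 : 'cV_b) = const_mx 1.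
  rewrite -mulmxA; apply: (can_inj (mulKmx Nunit)).
  rewrite mulKVmx//; apply/colP => k; rewrite mulmxBl mul1mx !mxE.
  apply/eqP; rewrite eq_sym subr_eq -[X in X == _](W1 k) big_split_ord /= addrC.
  by apply/eqP; congr (_ + _); apply: eq_bigr => j _; rewrite !mxE mulr1.
move=> /colP/(_ i); rewrite !mxE => <-.
by apply: eq_bigr => j _; rewrite [X in _ * X]mxE mulr1.
Qed.

(** First-step analysis: [(1 - W_AA) H = W_AB]. *)
Lemma exit_law_harmonic i j : \sum_k W (lshift b i) k * K k j = H i j.
Proof.
have : ulsubmx W *m H + ursubmx W = H.
  have : (1%:M - ulsubmx W) *m H = ursubmx W by rewrite mulKVmx.
  by rewrite mulmxBl mul1mx => <-; rewrite addrC subrK.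
move=> /matrixP/(_ i j) <-; rewrite big_split_ord /= mxE; congr (_ + _).
  by rewrite mxE; apply: eq_bigr => k _; rewrite col_mxEu !mxE.
rewrite (bigD1 j)//= col_mxEd !mxE eqxx mulr1 big1 ?addr0// => k kj.
by rewrite col_mxEd [X in _ * X]mxE (negbTE kj) mulr0.
Qed.

(** The limiting slow rows of [Q l *m K] are [Q_BA H + Q_BB], which is the reduced rate matrix. *)
Lemma slow_generator_lim i j :
  (Q l *m K - K *m L) (rshift a i) j @[l --> +oo%R] --> 0.
Proof.
have LE : L i j = \sum_k lim_rate_mx Q (rshift a i) k * K k j.
  rewrite /L /reduced_rate_mx -mulmxA -/W -/N -/H mxE addrC big_split_ord /=.
  congr (_ + _).
    by rewrite mxE; apply: eq_bigr => k _; rewrite col_mxEu !mxE.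
  rewrite (bigD1 j)//= col_mxEd !mxE eqxx mulr1 big1 ?addr0// => k kj.
  by rewrite col_mxEd [X in _ * X]mxE (negbTE kj) mulr0.
have -> : (fun l => (Q l *m K - K *m L) (rshift a i) j) =
    fun l => \sum_k Q l (rshift a i) k * K k j - L i j.
  apply/funext => l; rewrite mxE [X in _ + X]mxE mul_col_mx col_mxEd mul1mx.
  by rewrite mxE.
rewrite -[X in _ --> X](subrr (L i j)) [X in _ --> X - _]LE.
apply: cvgB; last exact: cvg_cst.
apply: cvg_sumr => k _; apply: cvgM; last exact: cvg_cst.
by apply: slow_rate_cvg => //; exact: rshift_slow.
Qed.

(** After normalization the first term tends to a fast row of [(W - I) K], zero by harmonicity, and
    the fixed [K *m L] is divided by a diverging rate. *)
Lemma fast_generator_lim i j :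
  (Q l *m K - K *m L) (lshift b i) j / exit_rate (Q l) (lshift b i)
    @[l --> +oo%R] --> 0.
Proof.
have fi := lshift_fast i.
have -> : (fun l => (Q l *m K - K *m L) (lshift b i) j /
    exit_rate (Q l) (lshift b i)) =
  fun l => \sum_k (Q l (lshift b i) k / exit_rate (Q l) (lshift b i)) * K k j -
    (K *m L) (lshift b i) j * (exit_rate (Q l) (lshift b i))^-1.
  apply/funext => l; rewrite mxE [X in _ + X]mxE mulrDl mulNr; congr (_ - _).
  by rewrite mxE mulr_suml; apply: eq_bigr => k _; rewrite mulrAC.
have lim0 : \sum_k (W (lshift b i) k - (lshift b i == k)%:R) * K k j -
    (K *m L) (lshift b i) j * 0 = 0.
  rewrite mulr0 subr0; under eq_bigr do rewrite mulrBl.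
  rewrite sumrB exit_law_harmonic (bigD1 (lshift b i))//= eqxx mul1r col_mxEu.
  rewrite big1 ?addr0 ?subrr// => k.
  by rewrite eq_sym => /negbTE ->; rewrite mul0r.
rewrite -[X in _ --> X]lim0; apply: cvgB.
  apply: cvg_sumr => k _; apply: cvgM; last exact: cvg_cst.
  exact: fast_rate_ratio_cvg.
by apply: cvgM; [exact: cvg_cst|exact: fast_exit_rateV_cvg0].
Qed.

Let c : 'rV[R]_a :=
  \row_j (\sum_i lim_rate_mx Q (rshift a i) (lshift b j) + 1).
Let x := c *m N.

(* A stationary supersolution for the forward equation at the fast states: the
   factor 1 / exit_rate makes it vanish in the limit, and the constant 1 in c
   makes the inequality strict. *)
Let zA l : 'rV[R]_a := \row_i (x 0 i / exit_rate (Q l) (lshift b i)).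
Let z l := row_mx (zA l) (const_mx 1 : 'rV[R]_b).

Let x_ge0 i : 0 <= x 0 i.
Proof.
rewrite mxE sumr_ge0// => j _; rewrite mulr_ge0 ?fast_block_inv_ge0//.
rewrite mxE addr_ge0// sumr_ge0// => k _; rewrite mxE fine_ge0//.
by apply: lim_rate_ge0 => //; rewrite eq_rlshift.
Qed.

Lemma supersolution_cvg0 i : zA l 0 i @[l --> +oo%R] --> 0.
Proof.
rewrite -[X in _ --> X](mulr0 (x 0 i)).
under eq_fun do rewrite mxE.
apply: cvgM; first exact: cvg_cst.
by apply: fast_exit_rateV_cvg0 => //; exact: lshift_fast.
Qed.

Lemma near_supersolution_ge0 :
  \forall l \near +oo%R, forall i, 0 <= zA l 0 i.
Proof.
apply: filter_forall => i.
have ei := fast_exit_rate_gt0 Qrate Qlim (lshift_fast i).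
near=> l; rewrite mxE divr_ge0// ltW//; near: l; exact: ei.
Unshelve. all: by end_near. Qed.

(** The limit is [x (W_AA - I)] plus the rates from slow to fast, that is [-c + (c - 1) = -1]. *)
Lemma near_supersolution :
  \forall l \near +oo%R, forall j, (z l *m Q l) 0 (lshift b j) < 0.
Proof.
apply: filter_forall => j.
suff zQ : (z l *m Q l) 0 (lshift b j) @[l --> +oo%R] --> (-1 : R).
  by apply: (cvgr_lt _ zQ); rewrite ltrN10.
have xc : x *m (1%:M - ulsubmx W) = c by rewrite mulmxKV.
have -> : (fun l => (z l *m Q l) 0 (lshift b j)) = fun l =>
    \sum_i x 0 i * (Q l (lshift b i) (lshift b j) /
      exit_rate (Q l) (lshift b i)) +
    \sum_i Q l (rshift a i) (lshift b j).
  apply/funext => l; rewrite mxE big_split_ord /=; congr (_ + _).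
    by apply: eq_bigr => i _; rewrite row_mxEl mxE mulrAC mulrA.
  by apply: eq_bigr => i _; rewrite row_mxEr mxE mul1r.
have <- : \sum_i x 0 i * (W (lshift b i) (lshift b j) -
      (lshift b i == lshift b j)%:R) +
    \sum_i lim_rate_mx Q (rshift a i) (lshift b j) = -1.
  have -> : \sum_i x 0 i * (W (lshift b i) (lshift b j) -
      (lshift b i == lshift b j)%:R) = - c 0 j.
    rewrite -xc [in RHS]mxE -sumrN; apply: eq_bigr => i _.
    by rewrite !mxE eq_lshift -mulrN opprB.
  by rewrite mxE opprD addrAC addNr add0r.
apply: cvgD.
  apply: cvg_sumr => i _; apply: cvgM; first exact: cvg_cst.
  by apply: fast_rate_ratio_cvg => //; exact: lshift_fast.
by apply: cvg_sumr => i _; apply: slow_rate_cvg => //; exact: rshift_slow.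
Qed.

(** The weight [zA] supplies exactly the normalization under which the fast rows of the defect
    vanish; slow rows have weight 1. *)
Lemma generator_error_cvg0 :
  \sum_i z l 0 i * \sum_j `|(Q l *m K - K *m L) i j| @[l --> +oo%R] --> 0.
Proof.
apply: cvg_sumr0 => k _; under eq_fun do rewrite mulr_sumr.
apply: cvg_sumr0 => j _; case: (split_ordP k) => i ->; last first.
  have -> : (fun l => z l 0 (rshift a i) *
      `|(Q l *m K - K *m L) (rshift a i) j|) =
    fun l => `|(Q l *m K - K *m L) (rshift a i) j|.
    by apply/funext => l; rewrite row_mxEr [X in X * _]mxE mul1r.
  by rewrite -[X in _ --> X](normr0 R); apply: cvg_norm; exact: slow_generator_lim.
have ei := fast_exit_rate_gt0 Qrate Qlim (lshift_fast i).
have : x 0 i * `|(Q l *m K - K *m L) (lshift b i) j /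
    exit_rate (Q l) (lshift b i)| @[l --> +oo%R] --> x 0 i * `|0 : R|.
  apply: cvgM; first exact: cvg_cst.
  by apply: cvg_norm; exact: fast_generator_lim.
rewrite normr0 mulr0; apply: cvg_trans; apply: near_eq_cvg; near=> l.
rewrite row_mxEl [zA l 0 i]mxE normrM normfV.
rewrite (gtr0_norm (_ : 0 < exit_rate _ _)).
  by rewrite mulrA mulrAC.
by near: l; exact: ei.
Unshelve. all: by end_near. Qed.

(** The constants [T] and [rho] come from the reduced chain alone, so they stay fixed as the
    parameter grows. *)
Lemma near_dTV_semigroups (Pt : R -> R -> 'M[R]_(a + b)) (S : R -> 'M[R]_b)
    (mu : 'rV[R]_b) :
  (0 < b)%N -> irreducible_rate_mx L -> is_distr mu ->
  (forall l, 0 < l -> transition_semigroup (Pt l) (Q l)) ->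
  transition_semigroup S L ->
  exists2 f : R -> R, f l @[l --> +oo%R] --> 0 &
    \forall l \near +oo%R, forall t, 0 <= t ->
      dTV (extend0 mu *m Pt l t) (extend0 (mu *m S t)) <= f l.
Proof.
move=> b0 Lirr mud Psg Ssg.
have [T [rho [T0 rho0 rho1 contr]]] := semigroup_contraction Ssg b0 Lirr.
exists (fun l => \sum_i zA l 0 i +
  (T * (\sum_i z l 0 i * \sum_j `|(Q l *m K - K *m L) i j|) / (1 - rho) +
   \sum_i zA l 0 i * \sum_j `|H i j|)).
  have sum0 (v : 'I_a -> R) :
      \sum_i zA l 0 i * v i @[l --> +oo%R] --> 0.
    apply: cvg_sumr0 => i _; rewrite -[X in _ --> X](mul0r (v i)).
    by apply: cvgM; [exact: supersolution_cvg0|exact: cvg_cst].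
  rewrite -[X in _ --> X](addr0 0); apply: cvgD.
    by have := sum0 (fun=> 1); under eq_fun do under eq_bigr do rewrite mulr1.
  rewrite -[X in _ --> X](addr0 0); apply: cvgD; last exact: sum0.
  have lim0 : T * 0 / (1 - rho) = 0 by rewrite mulr0 mul0r.
  rewrite -[X in _ --> X]lim0.
  apply: cvgM; last exact: cvg_cst.
  by apply: cvgM; [exact: cvg_cst|exact: generator_error_cvg0].
have z0 := near_supersolution_ge0; have zQ := near_supersolution.
near=> l; have l0 : 0 < l by near: l; exact: near_pinfty_gt0.
move=> t t0; apply: dTV_semigroups_le => //; [exact: Psg|exact: exit_law_sum1| |].
  by near: l; exact: z0.
by near: l; exact: zQ.
Unshelve. all: by end_near. Qed.

End Main.

Theorem corollary2 (R : realType) (a b : nat) (Q : R -> 'M[R]_(a + b))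
  (Qrate : forall lambda, 0 < lambda -> rate_mx (Q lambda))
  (Qirr : forall lambda, 0 < lambda -> irreducible_rate_mx (Q lambda))
  (Qlim : forall i j : 'I_(a + b), i != j ->
    cvg ((Q lambda i j)%:E @[lambda --> +oo%R]))
  (fastE : fast_states Q = [set i : 'I_(a + b) | (i < a)%N])
  (slow_neq0 : slow_states Q !=set0)
  (slow_gt0 : forall i, slow_states Q i -> (0 < lim_exit_rate Q i)%E)
  (jump_lim : forall i j : 'I_(a + b), i != j ->
    cvg (jump_mx (Q lambda) i j @[lambda --> +oo%R]))
  (dE : measure_display) (E : measurableType dE)
  (PE : 'I_(a + b) -> probability E R) (eta : nat -> E -> 'I_(a + b))
  (eta_dtmc : forall i, is_dtmc (PE i) eta (delta_mx 0 i) (lim_jump_mx Q))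
  (eta_hits : forall i, fast_states Q i ->
    PE i [set w | (hitting_time (R := R) eta (slow_states Q) w < +oo)%E] = 1%E)
  (Girr : irreducible_rate_mx (reduced_rate_mx Q))
  (mu : 'rV[R]_b) (mu_distr : is_distr mu)
  (dX : measure_display) (TX : measurableType dX)
  (PX : R -> probability TX R) (X : R -> TX -> 'I_(a + b))
  (X_ctmc : forall lambda, 0 < lambda ->
    is_ctmc (PX lambda) X (extend0 mu) (Q lambda))
  (dY : measure_display) (TY : measurableType dY)
  (PY : probability TY R) (Y : R -> TY -> 'I_b)
  (Y_ctmc : is_ctmc PY Y mu (reduced_rate_mx Q)) :
  ereal_sup [set (dTV (law (PX lambda) (X t)) (extend0 (law PY (Y t))))%:E
            | t in [set t : R | 0 <= t]]
    @[lambda --> +oo%R] --> 0%E.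
Proof.
have jump_path i : fast_states Q i -> exists2 s,
    path (fun x y => 0 < lim_jump_mx Q x y) i s & slow_states Q (last i s).
  move=> /eta_hits; apply: dtmc_hit_path (eta_dtmc i).
  exact: lim_jump_ge0.
have b0 : (0 < b)%N.
  have [k /(slowE fastE) ak] := slow_neq0.
  by rewrite -(ltn_add2l a) addn0 (leq_ltn_trans ak).
(* The implication makes the statement total in [l], as [choice] demands; the zero function serves
   for [l <= 0]. *)
have XPt l : exists Pt, 0 < l -> transition_semigroup Pt (Q l) /\
    forall t, 0 <= t -> law (PX l) (X t) = extend0 mu *m Pt t.
  have [l0|_] := ltP 0 l; last by exists (fun=> 0).
  by have [Pt ? ?] := law_ctmc (X_ctmc _ l0); exists Pt.
have [Pt PtP] := choice XPt.
have [S Ssg Slaw] := law_ctmc Y_ctmc.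
have Psg l : 0 < l -> transition_semigroup (Pt l) (Q l) by move=> /PtP[].
have [f f0 near_f] := near_dTV_semigroups Qrate Qlim fastE jump_lim jump_path
  b0 Girr mu_distr Psg Ssg.
apply: (@squeeze_cvge _ _ _ _ (cst 0%E) _ (EFin \o f)); last 2 first.
- exact: cvg_cst.
- by apply: cvg_EFin; [exact: nearW|exact: f0].
near=> l; have l0 : 0 < l by near: l; exact: near_pinfty_gt0.
have fl : forall t, 0 <= t ->
    dTV (extend0 mu *m Pt l t) (extend0 (mu *m S t)) <= f l.
  by near: l; exact: near_f.
apply/andP; split.
  (* The time 0 keeps the supremum from being that of an empty set. *)
  apply: le_trans (ereal_sup_ubound _); last by exists 0 => /=.
  by rewrite lee_fin dTV_ge0.
apply: ge_ereal_sup => _ [t /= t0 <-]; rewrite lee_fin.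
by have [_ ->//] := PtP l l0; rewrite Slaw// fl.
Unshelve. all: by end_near. Qed.
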